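(* There is a constant $c$ such that if $q>cp^2$, then for every $n$ sufficiently large, the $(p,q)$-biased Clique game on $K_n$ is won by player $2$.
   Context: Two players, Alice (player 1, starting) and Bob (player 2), alternately colour uncoloured edges of the complete graph $K_n$, Alice in red and Bob in blue; in the $(p,q)$-biased version Alice colours $p$ edges per turn and Bob $q$ edges per turn. In the Clique game, Alice's score is $a=\omega(G[A])$ and Bob's is $b=\omega(G[B])$, the clique numbers of the red and blue graphs. When $q>p$, Bob (player 2) wins if at the end $b>a$. *)

(* Defs.v *)
From HB Require Import structures.
From mathcomp Require Import all_boot all_order all_algebra.
From mathcomp Require Import reals.

Set Implicit Arguments.
Unset Strict Implicit.
Unset Printing Implicit Defensive.

Section BiasedCliqueGame.
Variable n : nat.

(* A set of edges is a set of two-element subsets of the vertex set. *)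
Definition edge_set := {set {set 'I_n}}.

Definition complete_edges : edge_set := [set e : {set 'I_n} | #|e| == 2].

Definition is_clique (F : edge_set) (S : {set 'I_n}) : bool :=
  [forall x in S, forall y in S, (x != y) ==> ([set x; y] \in F)].

Definition clique_number (F : edge_set) : nat :=
  \max_(S : {set 'I_n} | is_clique F S) #|S|.

(* A position is given by the set A of red and the set B of blue edges. *)
Definition uncoloured (A B : edge_set) : edge_set :=
  complete_edges :\: (A :|: B).

(* If fewer than k edges are left, then all of them are coloured; a move is
   unordered, as nothing happens between the edges of a single turn. *)
Definition legal_move (k : nat) (A B M : edge_set) : Prop :=
  M \subset uncoloured A B /\ #|M| = minn k #|uncoloured A B|.

Inductive player := Alice | Bob.

(* Bob's strategies may depend on the list of all previous moves of both
   players, in chronological order. *)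
Definition strategy := seq edge_set -> edge_set.

(* [play p sigma t h A B]: the position (A, B) with player t to move arises,
   through the sequence of moves h, from the empty board in some game in which
   Alice makes arbitrary legal moves of p edges and Bob follows sigma. *)
Inductive play (p : nat) (sigma : strategy) :
    player -> seq edge_set -> edge_set -> edge_set -> Prop :=
| play_start : play p sigma Alice [::] set0 set0
| play_Alice h A B M :
    play p sigma Alice h A B -> legal_move p A B M ->
    play p sigma Bob (rcons h M) (A :|: M) B
| play_Bob h A B :
    play p sigma Bob h A B ->
    play p sigma Alice (rcons h (sigma h)) A (B :|: sigma h).

(* For p, q > 0 every turn colours an edge until none is left, so each game
   reaches a position without uncoloured edges; from then on turns are empty. *)
Definition winning_strategy (p q : nat) (sigma : strategy) : Prop :=
  (forall h A B, play p sigma Bob h A B -> legal_move q A B (sigma h)) /\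
  (forall t h A B, play p sigma t h A B -> uncoloured A B = set0 ->
     clique_number A < clique_number B).

End BiasedCliqueGame.

Definition Bob_wins_clique_game (p q n : nat) : Prop :=
  exists sigma : strategy n, winning_strategy p q sigma.

(* Main.v *)
Require Import Defs.
From HB Require Import structures.
From mathcomp Require Import all_boot all_order all_algebra.
From mathcomp Require Import reals.
From mathcomp Require Import boolp.
From mathcomp Require Import zify ring lra.
Set Implicit Arguments.
Unset Strict Implicit.
Import Order.TTheory GRing.Theory Num.Theory.
Local Open Scope ring_scope.

(** Bob greedily colours the most dangerous edges for the potential that sums,
    over all vertex sets [X], the weights
    [n ^ -|X| * (1 + 1/p) ^ red(X) * (1 + 1/s) ^ -blue(X)].  As [q >= 3 (s + 1)],
    what he gains in a turn makes up for what Alice adds in the next one, so the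
    potential stays bounded and at the end every [X] satisfies
    [red(X) <= (|X| + 1) p log n + 2 (p / s) binom(|X|, 2)].  Hence red cliques have
    size [O(p log n)], while every [X] much larger than [s log n] has red density
    [O(p / s)].  Passing repeatedly to the blue neighbourhood of a vertex of small
    red degree then gives a blue clique of size of order [(s / p) log n], which is
    the larger one when [s] is a large multiple of [p^2]. *)

(** * Bounds on powers of [1 + 1/d] *)

(** Bernoulli's inequality [(1 - 1/(d+1))^j >= 1 - j/(d+1) >= 1/2], cleared of denominators. *)
Lemma bernoulli_double (d j : nat) : (j.*2 <= d.+1)%N -> (d.+1 ^ j <= 2 * d ^ j)%N.
Proof.
move=> hj.
have H i : (i <= d.+1)%N -> ((d.+1 - i) * d.+1 ^ i <= d.+1 * d ^ i)%N.
  elim: i => [|i IH] hi; first by rewrite !expn0 subn0.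
  have := IH (ltnW hi); rewrite !expnS; move: (d.+1 ^ i)%N (d ^ i)%N => a b hab.
  have : (d * ((d.+1 - i) * a) <= d * (d.+1 * b))%N by rewrite leq_mul2l hab orbT.
  have -> : (d.+1 - i = (d.+1 - i.+1).+1)%N by lia.
  have : (d.+1 - i.+1 <= d)%N by lia.
  move: (d.+1 - i.+1)%N => k hk; nia.
have := H j ltac:(lia); move: (d.+1 ^ j)%N (d ^ j)%N => a b; nia.
Qed.

(** The exponent splits into two halves, each at most [(d+1)/2], and each half costs a factor of at
    most 2. *)
Lemma succ_pow_le4 (d : nat) : (0 < d)%N -> (d.+1 ^ d <= 4 * d ^ d)%N.
Proof.
move=> d0.
have h1 := @bernoulli_double d (d./2) ltac:(lia).
have h2 := @bernoulli_double d (uphalf d) ltac:(lia).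
have e : (d = d./2 + uphalf d)%N by lia.
rewrite [X in (_ ^ X <= _)%N]e [X in (_ <= _ * _ ^ X)%N]e !expnD.
by have := leq_mul h1 h2; rewrite mulnACA.
Qed.

Section OneAddInv.
Variables (R : realFieldType) (d : nat).
Hypothesis d0 : (0 < d)%N.

Lemma one_add_inv_gt0 : 0 < 1 + d%:R^-1 :> R.
Proof. by rewrite ltr_pwDl // invr_ge0. Qed.

Lemma one_add_inv_pow_le4 : (1 + d%:R^-1) ^+ d <= 4 :> R.
Proof.
have dN0 : d%:R != 0 :> R by rewrite pnatr_eq0 -lt0n.
have -> : 1 + d%:R^-1 = d.+1%:R / d%:R :> R by rewrite -natr1; field.
rewrite expr_div_n ler_pdivrMr ?exprn_gt0 ?ltr0n //.
by rewrite -!natrX -natrM ler_nat succ_pow_le4.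
Qed.

Lemma one_add_inv_pow_ge2 : 2 <= (1 + d%:R^-1) ^+ d :> R.
Proof.
have d1 : 0 <= d%:R^-1 :> R by rewrite invr_ge0.
have H k : 1 + k%:R * d%:R^-1 <= (1 + d%:R^-1) ^+ k :> R.
  elim: k => [|k IH]; first by rewrite mul0r addr0 expr0.
  rewrite exprS -natr1; have k0 : 0 <= k%:R * d%:R^-1 ^+ 2 :> R.
    by rewrite mulr_ge0 // exprn_ge0.
  apply: le_trans (ler_wpM2l (ltW one_add_inv_gt0) IH).
  nra.
by have := H d; rewrite mulfV ?pnatr_eq0 -?lt0n.
Qed.
End OneAddInv.

(** * The potential and Bob's greedy strategy *)

Section Potential.
Variables (R : realFieldType) (n : nat).
Implicit Types (A B F M : edge_set n) (X : {set 'I_n}) (e f : {set 'I_n}).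

Definition edges_in F X : edge_set n := [set e in F | e \subset X].

Lemma edges_inU1 F X e :
  edges_in (e |: F) X = if e \subset X then e |: edges_in F X else edges_in F X.
Proof.
apply/setP=> f; case: ifP => eX; rewrite !inE.
  by case: eqP => [->|].
by case: eqP => [->|]; rewrite //= eX andbF.
Qed.

Lemma edges_in_le F X : F \subset complete_edges n ->
  (#|edges_in F X| <= 'C(#|X|, 2))%N.
Proof.
move=> Fc; rewrite -cards_draws; apply/subset_leq_card/subsetP => e.
by rewrite !inE => /andP[/(subsetP Fc)]; rewrite inE => -> ->.
Qed.

Variables (lam bet : R) (c : {set 'I_n} -> R).
Hypotheses (lam1 : 1 <= lam) (bet0 : 0 <= bet) (bet1 : bet <= 1).
Hypothesis c0 : forall X, 0 <= c X.

Definition weight A B X :=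
  c X * lam ^+ #|edges_in A X| * bet ^+ #|edges_in B X|.
Definition potential A B := \sum_X weight A B X.
(** The share of the potential that colouring a fresh edge [e] multiplies: by [lam] if red, by [bet]
    if blue. *)
Definition danger A B e := \sum_(X : {set 'I_n} | e \subset X) weight A B X.

Lemma weight_ge0 A B X : 0 <= weight A B X.
Proof. by rewrite !mulr_ge0 ?exprn_ge0 // (le_trans ler01). Qed.

Lemma danger_ge0 A B e : 0 <= danger A B e.
Proof. by apply: sumr_ge0 => X _; apply: weight_ge0. Qed.

Lemma danger_le_potential A B e : danger A B e <= potential A B.
Proof.
rewrite /potential (bigID (fun X : {set 'I_n} => e \subset X)) /= lerDl.
by apply: sumr_ge0 => X _; apply: weight_ge0.
Qed.

(** Only an inequality: if [e] is red already, the weight stays the same. *)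
Lemma weight_red A B X e :
  weight (e |: A) B X <= (if e \subset X then lam else 1) * weight A B X.
Proof.
rewrite /weight edges_inU1; case: ifP => eX; last by rewrite mul1r.
rewrite mulrA [lam * _]mulrCA; apply: ler_wpM2r; first by rewrite exprn_ge0.
apply: ler_wpM2l => //; rewrite cardsU1.
by case: (_ \notin _); rewrite ?add1n ?exprS // add0n ler_peMl ?exprn_ge0 // (le_trans ler01).
Qed.

Lemma weight_blue A B X e : e \notin B ->
  weight A (e |: B) X = (if e \subset X then bet else 1) * weight A B X.
Proof.
move=> eB; rewrite /weight edges_inU1; case: ifP => eX; last by rewrite mul1r.
by rewrite cardsU1 inE (negbTE eB) /= exprS mulrCA.
Qed.

Lemma potential_red A B e :
  potential (e |: A) B <= potential A B + (lam - 1) * danger A B e.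
Proof.
rewrite /potential /danger mulr_sumr [X in _ + X]big_mkcond -big_split /=.
apply: ler_sum => X _; apply: le_trans (weight_red A B X e) _.
by case: ifP => _; rewrite ?addr0 ?mul1r //; lra.
Qed.

Lemma danger_red A B e f : danger (e |: A) B f <= lam * danger A B f.
Proof.
rewrite /danger mulr_sumr; apply: ler_sum => X _.
apply: le_trans (weight_red A B X e) _; apply: ler_wpM2r; first exact: weight_ge0.
by case: ifP.
Qed.

Lemma potential_blue A B e : e \notin B ->
  potential A (e |: B) = potential A B - (1 - bet) * danger A B e.
Proof.
move=> eB; rewrite /potential /danger mulr_sumr [X in _ - X]big_mkcond -sumrB /=.
by apply: eq_bigr => X _; rewrite weight_blue //; case: ifP => _; ring.
Qed.

Lemma danger_blue A B e f : e \notin B -> danger A (e |: B) f <= danger A B f.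
Proof.
move=> eB; apply: ler_sum => X _; rewrite weight_blue //.
by apply: ler_piMl; [apply: weight_ge0 | case: ifP].
Qed.

(** Every red edge multiplies dangers by at most [lam], so the [i]-th one adds at most
    [(lam - 1) * lam^(i-1) * x]; the bound is the geometric sum. *)
Lemma potential_redU k A B F (x : R) : (#|F| <= k)%N -> 0 <= x ->
  (forall e, e \in F -> danger A B e <= x) ->
  potential (A :|: F) B <= potential A B + (lam ^+ k - 1) * x.
Proof.
elim: k A F x => [|k IH] A F x Fk x0 Fx.
  move: Fk; rewrite leqn0 cards_eq0 => /eqP ->.
  by rewrite setU0 expr0 subrr mul0r addr0.
have l0 : 0 <= lam by rewrite (le_trans ler01).
have [->|[e eF]] := set_0Vmem F.
  rewrite setU0 lerDl mulr_ge0 // subr_ge0 exprn_ege1 //.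
have Fk' : (#|F :\ e| <= k)%N by move: Fk; rewrite (cardsD1 e) eF.
have H f : f \in F :\ e -> danger (e |: A) B f <= lam * x.
  rewrite inE => /andP[_ fF]; apply: le_trans (danger_red _ _ _ _) _.
  by rewrite ler_wpM2l // Fx.
have := IH (e |: A) (F :\ e) _ Fk' (mulr_ge0 l0 x0) H.
have -> : (e |: A) :|: F :\ e = A :|: F.
  by rewrite -[in RHS](setD1K eF) [A :|: (_ |: _)]setUCA setUA.
move=> h; apply: le_trans h _.
apply: le_trans (lerD (potential_red A B e) (lexx _)) _.
have : (lam - 1) * danger A B e <= (lam - 1) * x by rewrite ler_wpM2l ?subr_ge0 ?Fx.
rewrite exprS; lra.
Qed.

(* The edges chosen greedily each have at least the danger of any edge left
   afterwards, because dangers only decrease during Bob's turn. *)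
Lemma greedy_blue k A B : exists M (x : R),
  [/\ legal_move k A B M, 0 <= x,
      potential A (B :|: M) + k%:R * (1 - bet) * x <= potential A B &
      forall e, e \in uncoloured A (B :|: M) -> danger A (B :|: M) e <= x].
Proof.
elim: k => [|k [M [x [[Mu Mk] x0 pot dan]]]].
  exists set0, (potential A B); split.
  - by split; [apply: sub0set | rewrite cards0 min0n].
  - by apply: sumr_ge0 => X _; apply: weight_ge0.
  - by rewrite setU0 !mul0r addr0.
  - by move=> e _; rewrite setU0 danger_le_potential.
have uE : uncoloured A (B :|: M) = uncoloured A B :\: M.
  by rewrite /uncoloured setDDl setUA.
have cE : #|uncoloured A B| = (#|M| + #|uncoloured A (B :|: M)|)%N.
  by rewrite uE cardsD (setIidPr Mu) subnKC // subset_leq_card.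
have [u0|[e0 ue0]] := set_0Vmem (uncoloured A (B :|: M)).
  (* Once no edge is left the bound on dangers is vacuous, so [x = 0] is allowed and no gain has to
     be shown. *)
  exists M, 0; split=> //; last by move=> e; rewrite u0 inE.
    split=> //; move: cE; rewrite u0 cards0; lia.
  rewrite mulr0 addr0; apply: le_trans pot; rewrite lerDl.
  by rewrite !mulr_ge0 // subr_ge0.
case: (arg_maxP (danger A (B :|: M)) ue0) => e.
rewrite -[is_true _]/(is_true (e \in _)) => ue emax.
have eM : e \notin M by move: ue; rewrite uE inE => /andP[].
have eB : e \notin B :|: M.
  by move: ue; rewrite inE => /andP[]; rewrite inE negb_or => /andP[].
have BE : B :|: (e |: M) = e |: (B :|: M) by rewrite setUCA.
exists (e |: M), (danger A (B :|: M) e); rewrite BE; split.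
- split.
    by rewrite subUset Mu andbT sub1set; move: ue; rewrite uE inE => /andP[].
  have : (0 < #|uncoloured A (B :|: M)|)%N by apply/card_gt0P; exists e.
  rewrite cardsU1 eM; move: cE Mk; lia.
- exact: danger_ge0.
- rewrite potential_blue // -natr1.
  have : k%:R * (1 - bet) * danger A (B :|: M) e <= k%:R * (1 - bet) * x.
    by rewrite ler_wpM2l ?dan // mulr_ge0 // subr_ge0.
  lra.
- move=> f uf; apply: le_trans (danger_blue _ _ eB) _; apply: emax.
  have: uncoloured A (e |: (B :|: M)) \subset uncoloured A (B :|: M).
    by rewrite setDS // setUS // subsetUr.
  by move/subsetP; apply.
Qed.

(** A strategy sees only the moves, so the position is rebuilt from them; the Boolean is true when
    Alice is to move. *)
Definition history_position (h : seq (edge_set n)) : bool * edge_set n * edge_set n :=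
  foldl (fun s M => let: (b, A, B) := s in
    if b then (false, A :|: M, B) else (true, A, B :|: M)) (true, set0, set0) h.

Lemma play_position p sigma t h A B : play p sigma t h A B ->
  history_position h = (if t is Alice then true else false, A, B).
Proof.
by elim=> {t h A B} [|h A B M _ IH _|h A B _ IH] //;
  rewrite /history_position foldl_rcons -/(history_position h) IH.
Qed.

(** Bob's gain of at least [q * (1 - bet) * x] covers the at most [(lam ^+ p - 1) * x] that Alice
    adds next. The factor [lam ^+ p] pays for her opening turn, which no turn of Bob precedes. *)
Lemma potential_strategy p q : lam ^+ p - 1 <= q%:R * (1 - bet) ->
  exists sigma : strategy n,
  (forall h A B, play p sigma Bob h A B -> legal_move q A B (sigma h)) /\
  (forall t h A B, play p sigma t h A B -> uncoloured A B = set0 ->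
     A :|: B = complete_edges n /\ potential A B <= lam ^+ p * \sum_X c X).
Proof.
move=> lq.
have resp (AB : edge_set n * edge_set n) : exists M, legal_move q AB.1 AB.2 M /\
    forall F, legal_move p AB.1 (AB.2 :|: M) F ->
      potential (AB.1 :|: F) (AB.2 :|: M) <= potential AB.1 AB.2.
  case: AB => A B /=; have [M [x [legM x0 pot dan]]] := greedy_blue q A B.
  exists M; split=> // F [Fu Fp].
  have := @potential_redU p A (B :|: M) F x; rewrite Fp geq_minl => /(_ isT x0).
  move=> /(_ (fun e eF => dan e (subsetP Fu e eF))) h.
  apply: le_trans h _; apply: le_trans pot; rewrite lerD2l.
  exact: ler_wpM2r.
have [g gP] := choice resp.
pose sigma (h : seq (edge_set n)) := let: (_, A, B) := history_position h in g (A, B).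
have sigmaE t h A B : play p sigma t h A B -> sigma h = g (A, B).
  by move=> /play_position hp; rewrite /sigma hp.
exists sigma; split.
  by move=> h A B H; rewrite (sigmaE _ _ _ _ H); have [] := gP (A, B).
(* With Alice to move, the bound is stated after any legal answer of hers, since Bob's gain is
   balanced against her next turn; with Bob to move it concerns the position itself. *)
have inv t h A B : play p sigma t h A B -> A :|: B \subset complete_edges n /\
    (forall F, (if t is Alice then legal_move p A B F else F = set0) ->
      potential (A :|: F) B <= lam ^+ p * \sum_X c X).
  elim=> {t h A B} [|h A B M _ [sc IH] legM|h A B H [sc IH]].
  - split=> [|F [_ Fp]]; first by rewrite setU0 sub0set.
    have p0 : potential set0 set0 = \sum_X c X.
      apply: eq_bigr => X _; rewrite /weight /edges_in.
      have -> : [set e in (set0 : edge_set n) | e \subset X] = set0.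
        by apply/setP => e; rewrite !inE.
      by rewrite cards0 !expr0 !mulr1.
    apply: le_trans (potential_redU (k := p) _ _ (fun e _ => danger_le_potential _ _ e)) _.
    + by rewrite Fp geq_minl.
    + by rewrite p0 sumr_ge0.
    + by rewrite p0; lra.
  - split=> [|F ->]; last by rewrite setU0 IH.
    rewrite setUAC subUset sc; apply: subset_trans (proj1 legM) _.
    exact: subsetDl.
  - have /= [legM good] := gP (A, B); rewrite (sigmaE _ _ _ _ H); split=> [|F legF].
      rewrite setUA subUset sc; apply: subset_trans (proj1 legM) _.
      exact: subsetDl.
    by apply: le_trans (good F legF) _; rewrite -[A in potential A]setU0 IH.
move=> t h A B /inv [sc pot] u0; split.
  by apply/eqP; rewrite eqEsubset sc -setD_eq0; apply/eqP.
(* On a full board the empty move is legal for Alice, so the invariant applies to it. *)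
rewrite -[A]setU0; apply: pot; case: t => //.
by split; [apply: sub0set | rewrite u0 !cards0 minn0].
Qed.

End Potential.

(** * From a bounded potential to few red edges and small red cliques *)

(** The product of [1/n + 1] over all vertices expands into this sum. *)
Lemma sum_subsets_inv_le4 (R : realFieldType) (n : nat) : (0 < n)%N ->
  \sum_(X : {set 'I_n}) n%:R^-1 ^+ #|X| <= 4 :> R.
Proof.
move=> n0; suff -> : \sum_(X : {set 'I_n}) n%:R^-1 ^+ #|X| = (1 + n%:R^-1) ^+ n :> R.
  exact: one_add_inv_pow_le4.
have <- : \prod_(i : 'I_n) (n%:R^-1 + 1) = (1 + n%:R^-1) ^+ n :> R.
  by rewrite prodr_const card_ord addrC.
rewrite bigA_distr /=; apply: eq_bigr => X _.
by rewrite -big_mkcond /= prodr_const.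
Qed.

(** Logarithms are avoided by raising to the power [p * s] and comparing powers of 2, with
    [(1 + 1/p)^p >= 2] and [(1 + 1/s)^s <= 4]. The constant 16 is absorbed into one more factor
    [n]. *)
Lemma red_edges_bound (R : realFieldType) (n p s L r b m E : nat) :
  (0 < p)%N -> (0 < s)%N -> (16 <= n)%N -> (n <= 2 ^ L)%N -> (b <= E)%N ->
  (1 + p%:R^-1) ^+ r * (1 + s%:R^-1)^-1 ^+ b <= 16 * n%:R ^+ m :> R ->
  (r * s <= m.+1 * p * s * L + 2 * E * p)%N.
Proof.
move=> p0 s0 n16 nL bE.
set x := 1 + p%:R^-1; set y := 1 + s%:R^-1.
have x1 : 1 <= x by rewrite lerDl invr_ge0.
have y1 : 1 <= y by rewrite lerDl invr_ge0.
have y0 : 0 < y := lt_le_trans ltr01 y1.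
have yn := ltW y0.
have x0 : 0 <= x := le_trans ler01 x1.
rewrite exprVn ler_pdivrMr ?exprn_gt0 // => h.
have {}h : x ^+ r <= n%:R ^+ m.+1 * y ^+ E.
  apply: le_trans h _; apply: ler_pM; rewrite ?mulr_ge0 ?exprn_ge0 //.
    by rewrite exprS ler_wpM2r ?exprn_ge0 // ler_nat.
  by rewrite ler_weXn2l.
have {}h : (x ^+ r) ^+ (p * s) <= (n%:R ^+ m.+1 * y ^+ E) ^+ (p * s).
  by rewrite lerXn2r // nnegrE ?mulr_ge0 ?exprn_ge0.
have h1 : 2 ^+ (r * s) <= (x ^+ r) ^+ (p * s).
  rewrite -exprM mulnCA (exprM x) lerXn2r ?nnegrE ?exprn_ge0 //.
  exact: one_add_inv_pow_ge2.
have h2 : (n%:R ^+ m.+1 * y ^+ E) ^+ (p * s) <= 2 ^+ (m.+1 * p * s * L + 2 * E * p).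
  rewrite exprMn exprD; apply: ler_pM; rewrite ?exprn_ge0 //.
    rewrite -exprM [(m.+1 * p * s * L)%N]mulnC mulnA (exprM _ L) lerXn2r ?nnegrE ?exprn_ge0 //.
    by rewrite -natrX ler_nat.
  rewrite -exprM (_ : E * (p * s) = s * (E * p))%N; last by lia.
  rewrite -mulnA !(exprM _ _ (E * p)) lerXn2r ?nnegrE ?exprn_ge0 //.
  by apply: le_trans (one_add_inv_pow_le4 R s0) _; rewrite -natrX ler_nat.
have := le_trans (le_trans h1 h) h2.
by rewrite ler_eXn2l // ltr1n.
Qed.

(** The handshake lemma inside [X], by exchanging the sums over vertices and edges. *)
Lemma sum_degrees (n : nat) (F : edge_set n) (X : {set 'I_n}) :
  F \subset complete_edges n ->
  (\sum_(v in X) #|[set e in edges_in F X | v \in e]| = 2 * #|edges_in F X|)%N.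
Proof.
move=> Fc.
transitivity (\sum_(v in X) \sum_(e in edges_in F X) (v \in e : nat))%N.
  apply: eq_bigr => v _; rewrite -sum1_card.
  rewrite (eq_bigl (fun e => (e \in edges_in F X) && (v \in e))) => [|e]; last by rewrite inE.
  by rewrite -big_mkcondr.
rewrite exchange_big /= mulnC -sum_nat_const; apply: eq_bigr => e.
rewrite inE => /andP[/(subsetP Fc)]; rewrite inE => /eqP <- eX.
rewrite -sum1_card [RHS](eq_bigl (fun v => (v \in X) && (v \in e))) => [|v].
  by rewrite -big_mkcondr.
by case: (boolP (v \in e)) => [/(subsetP eX) ->|]; rewrite ?andbT ?andbF.
Qed.

(** As [s >= 6 * p], the term [2 * E * p] is at most a third of [E * s], which leaves [m * (m - 1) =
    2 * E <= (m + 1) * 3 * p * L]. For [m >= 3 * p * L + 3] the right side is at most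
    [(m + 1) * (m - 3)], which is too small. *)
Lemma red_clique_small (n : nat) (A : edge_set n) (p d s L : nat) (X : {set 'I_n}) :
  (0 < p)%N -> s = (6 * p * d.+1)%N ->
  (#|edges_in A X| * s <= #|X|.+1 * p * s * L + 2 * 'C(#|X|, 2) * p)%N ->
  is_clique A X -> (#|X| <= 3 * p * L + 2)%N.
Proof.
move=> p0 sE red XA; have Xr : ('C(#|X|, 2) <= #|edges_in A X|)%N.
  rewrite -cards_draws; apply/subset_leq_card/subsetP => e.
  rewrite inE => /andP[eX /cards2P[x [y [xy ee]]]]; rewrite inE eX andbT ee.
  move: eX; rewrite ee subUset !sub1set => /andP[xX yX].
  exact: (implyP (forall_inP (forall_inP XA x xX) y yX) xy).
move: red; have := mul_bin_diag #|X| 1; rewrite bin1.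
move: Xr; move: #|X| 'C(#|X|, 2) #|edges_in A X| => m E r Er E2 hr.
rewrite leqNgt; apply/negP => hm.
have Es : (E * s <= r * s)%N by rewrite leq_mul2r Er orbT.
have Ep : (6 * E * p <= E * s)%N by rewrite sE; nia.
have h1 : (s * (2 * E) <= s * (m.+1 * (3 * p * L)))%N by nia.
have {}h1 : (2 * E <= m.+1 * (3 * p * L))%N.
  by rewrite leq_pmul2l // sE !muln_gt0 p0 in h1.
have h2 : (m.+1 * (3 * p * L) <= m.+1 * (m - 3))%N by rewrite leq_mul2l; lia.
case: m {hr Es Ep} hm h1 h2 E2 => [|[|[|m]]] hm h1 h2 E2; nia.
Qed.

(** * Blue cliques from repeated blue neighbourhoods *)

Section CliqueGrowth.
Variables (n : nat) (B : edge_set n).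

Definition blue_nbrs (X : {set 'I_n}) (v : 'I_n) :=
  [set u in X | (u != v) && ([set v; u] \in B)].

Lemma clique_number_gt (k : nat) (S : {set 'I_n}) :
  is_clique B S -> (k < #|S|)%N -> (k < clique_number B)%N.
Proof.
by move=> SB kS; apply: leq_trans kS (leq_bigmax_cond _ SB).
Qed.

(* Each step passes to the blue neighbourhood, inside the current set, of a
   vertex of it; the set shrinks at most by the factor [d / (d + 1)]. *)
Lemma blue_clique (d M0 : nat) : (0 < M0)%N ->
  (forall X : {set 'I_n}, (M0 <= #|X|)%N ->
     exists2 v, v \in X & (d * #|X| <= d.+1 * #|blue_nbrs X v|)%N) ->
  forall t (X : {set 'I_n}), (M0 * d.+1 ^ t <= #|X| * d ^ t)%N ->
  exists S : {set 'I_n}, [/\ S \subset X, is_clique B S & #|S| = t].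
Proof.
move=> M0_gt0 step; elim=> [|t IH] X hX.
  exists set0; split; rewrite ?sub0set ?cards0 //.
  by apply/forallP => x; rewrite inE.
have [v vX hv] : exists2 v, v \in X & (d * #|X| <= d.+1 * #|blue_nbrs X v|)%N.
  (* Since [d ^ t.+1 <= d.+1 ^ t.+1], the assumed size of [X] forces [M0 <= #|X|]. *)
  apply: step; rewrite -(leq_pmul2r (m := d.+1 ^ t.+1)) ?expn_gt0 //.
  by apply: leq_trans hX _; rewrite leq_mul2l leq_exp2r // leqnSn orbT.
have [|S [SX Scl St]] := IH (blue_nbrs X v).
  rewrite -(leq_pmul2l (m := d.+1)) //.
  have := leq_mul hv (leqnn (d ^ t)).
  move: hX; rewrite !expnS; move: (d.+1 ^ t)%N (d ^ t)%N => a b; lia.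
have vS u : u \in S -> [/\ u \in X, u != v & [set v; u] \in B].
  by move=> /(subsetP SX); rewrite inE => /and3P[].
exists (v |: S); split.
- by rewrite subUset sub1set vX /=; apply/subsetP => u /vS[].
- apply/forall_inP => x; rewrite !inE => /orP[/eqP ->|xS];
    apply/forall_inP => y; rewrite !inE => /orP[/eqP ->|yS].
  + by rewrite eqxx.
  + by apply/implyP => _; have [] := vS _ yS.
  + by apply/implyP => _; rewrite setUC; have [] := vS _ xS.
  + exact: (forall_inP (forall_inP Scl x xS) y yS).
- by rewrite cardsU1 St; case: (boolP (v \in S)) => // /vS[]; rewrite eqxx.
Qed.

End CliqueGrowth.

Section Endgame.
Variables (n : nat) (A B : edge_set n).
Hypothesis AB : A :|: B = complete_edges n.

Let AE : A \subset complete_edges n.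
Proof. by rewrite -AB subsetUl. Qed.

(** All edges are coloured, so every vertex of [X] other than [v] is a blue neighbour or gives its
    own red edge at [v]; the 1 counts [v]. *)
Lemma card_blue_nbrs (X : {set 'I_n}) (v : 'I_n) : v \in X ->
  (#|X| <= #|blue_nbrs B X v| + #|[set e in edges_in A X | v \in e]| + 1)%N.
Proof.
move=> vX.
pose W := [set u in X | (u != v) && ([set v; u] \in A)].
have inj : {in W &, injective (fun u => [set v; u])}.
  move=> u w; rewrite !inE => /and3P[_ uv _] _ /= uw.
  by have := set22 v u; rewrite uw !inE (negbTE uv) => /eqP.
have cW : (#|W| <= #|[set e in edges_in A X | v \in e]|)%N.
  rewrite -(card_in_imset inj); apply/subset_leq_card/subsetP => e /imsetP[u].
  rewrite inE => /and3P[uX uv uA] ->.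
  by rewrite !inE uA eqxx subUset !sub1set vX uX.
have : X \subset blue_nbrs B X v :|: W :|: [set v].
  apply/subsetP => u uX; rewrite !inE uX /=.
  have [->|uv] := eqVneq u v; first by rewrite orbT.
  have : [set v; u] \in A :|: B by rewrite AB inE cards2 (eq_sym v) uv.
  by rewrite inE => /orP[] ->; rewrite ?orbT.
move=> /subset_leq_card h; have := (leq_card_setU (blue_nbrs B X v :|: W) [set v]).1.
have := (leq_card_setU (blue_nbrs B X v) W).1; rewrite cards1.
move: h cW; lia.
Qed.

Variables (p d s L : nat).
Hypotheses (p0 : (0 < p)%N) (sE : s = (6 * p * d.+1)%N).
Hypothesis red : forall X : {set 'I_n},
  (#|edges_in A X| * s <= #|X|.+1 * p * s * L + 2 * 'C(#|X|, 2) * p)%N.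

(** If every vertex failed, all red degrees in [X] would be large, and summing gives
    [m * (m + 1) <= (d + 1) * (m + 2 * r)]. The term [2 * s * L + 2] of the threshold makes
    [r * s <= 3 * p * E], that is [2 * (d + 1) * r <= E]; the term [2 * d.+1] then yields the
    contradiction. *)
Lemma blue_step (X : {set 'I_n}) : (2 * s * L + 2 + 2 * d.+1 <= #|X|)%N ->
  exists2 v, v \in X & (d * #|X| <= d.+1 * #|blue_nbrs B X v|)%N.
Proof.
move=> hX; apply: contrapT => no.
have deg v : v \in X ->
    (#|X|.+1 <= d.+1 * (1 + #|[set e in edges_in A X | v \in e]|))%N.
  move=> vX; rewrite ltnNge; apply/negP => hv; apply: no; exists v => //.
  have := leq_mul (leqnn d.+1) (card_blue_nbrs vX); move: hv.
  move: #|X| #|blue_nbrs B X v| #|[set e in edges_in A X | v \in e]| => m b g.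
  clear; lia.
have : (\sum_(v in X) #|X|.+1 <=
    \sum_(v in X) d.+1 * (1 + #|[set e in edges_in A X | v \in e]|))%N.
  exact: leq_sum.
rewrite sum_nat_const -big_distrr /= big_split /= sum_degrees // sum1_card.
have := red X; have := mul_bin_diag #|X| 1; rewrite bin1.
move: hX; move: #|X| 'C(#|X|, 2) #|edges_in A X| => m E r hm E2 hr hsum.
have h1 : (m.+1 * (2 * s * L) <= 2 * E)%N.
  rewrite -E2; move: (2 * s * L)%N hm => T hm.
  apply: (@leq_trans (m.+1 * (m - 2))); first by rewrite leq_mul2l; lia.
  by clear -hm; nia.
have h2 : (3 * p * (2 * d.+1 * r) <= 3 * p * E)%N by rewrite sE in hr h1; nia.
rewrite leq_pmul2l ?muln_gt0 ?p0 // in h2.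
case: m hm E2 hsum {hr h1} => [|m] /= hm E2 hsum; nia.
Qed.

End Endgame.

(** * Choice of the parameters and comparison of the two cliques *)

(** Here [1 - bet = 1/(s+1)] and [lam ^+ p - 1 <= 3], so [q >= 3 * (s + 1)] is what the balance of
    the turns needs. *)
Lemma strategy_red_sparse (R : realFieldType) (n p q s L : nat) :
  (0 < p)%N -> (0 < s)%N -> (3 * s.+1 <= q)%N -> (16 <= n)%N -> (n <= 2 ^ L)%N ->
  exists sigma : strategy n,
  (forall h A B, play p sigma Bob h A B -> legal_move q A B (sigma h)) /\
  (forall t h A B, play p sigma t h A B -> uncoloured A B = set0 ->
     A :|: B = complete_edges n /\
     forall X : {set 'I_n},
       (#|edges_in A X| * s <= #|X|.+1 * p * s * L + 2 * 'C(#|X|, 2) * p)%N).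
Proof.
move=> p0 s0 sq n16 nL.
have n0 : (0 < n)%N by apply: leq_trans n16.
pose lam : R := 1 + p%:R^-1; pose bet : R := (1 + s%:R^-1)^-1.
pose c (X : {set 'I_n}) : R := n%:R^-1 ^+ #|X|.
have lam1 : 1 <= lam by rewrite lerDl invr_ge0.
have lamp : lam ^+ p <= 4 by apply: one_add_inv_pow_le4.
have y0 : 0 < 1 + s%:R^-1 :> R by apply: one_add_inv_gt0.
have bet0 : 0 <= bet by rewrite invr_ge0 ltW.
have bet1 : bet <= 1 by rewrite invf_le1 // lerDl invr_ge0.
have c0 X : 0 <= c X by rewrite exprn_ge0 // invr_ge0.
have betE : 1 - bet = s.+1%:R^-1.
  have sN0 : s%:R != 0 :> R by rewrite pnatr_eq0 -lt0n.
  have s1N0 : s%:R + 1 != 0 :> R by rewrite natr1 pnatr_eq0.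
  by rewrite /bet -natr1; field; rewrite ?sN0 ?s1N0.
have lq : lam ^+ p - 1 <= q%:R * (1 - bet).
  rewrite betE ler_pdivlMr ?ltr0n //.
  have : 3 * s.+1%:R <= q%:R :> R by rewrite -natrM ler_nat.
  have : (lam ^+ p - 1) * s.+1%:R <= 3 * s.+1%:R.
    by rewrite ler_wpM2r //; lra.
  lra.
have [sigma [leg fin]] := potential_strategy lam1 bet0 bet1 c0 lq.
exists sigma; split=> // t h A B H u0; have [AB pot] := fin t h A B H u0.
split=> // X.
have Bc : B \subset complete_edges n by rewrite -AB subsetUr.
apply: (@red_edges_bound R n p s L _ #|edges_in B X|) => //; first exact: edges_in_le.
rewrite -ler_pdivrMr ?exprn_gt0 ?ltr0n // mulrC mulrA -exprVn.
apply: le_trans (_ : potential lam bet c A B <= _).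
  rewrite /potential (bigD1 X) //= lerDl; apply: sumr_ge0 => Y _.
  exact: weight_ge0.
(* One 4 bounds [lam ^+ p], the other the initial potential. *)
apply: le_trans pot _; rewrite (_ : 16 = 4 * 4); last by ring.
apply: ler_pM lamp (sum_subsets_inv_le4 R n0); last by apply: sumr_ge0 => Y _; apply: c0.
by rewrite exprn_ge0 // (le_trans ler01).
Qed.

Theorem theorem3p4 (R : realType) :
  exists c : R, forall p q : nat, (0 < p)%N -> (0 < q)%N ->
    c * p%:R ^+ 2 < q%:R ->
    exists N : nat, forall n : nat, (N <= n)%N -> Bob_wins_clique_game p q n.
Proof.
(* [3 * (s + 1) = 468 * p^2 + 18 * p + 3 <= 489 * p^2]. *)
exists 489%:R => p q p0 _; rewrite -natrX -natrM ltr_nat => pq.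
(* This [d] makes the blue clique size [d * K] exceed the red bound [12 * p * (K + 1) + 2] once
   [K >= 2]. *)
pose d := (26 * p)%N; pose s := (6 * p * d.+1)%N; pose C := (8 * s + 2 + 2 * d.+1)%N.
have sq : (3 * s.+1 <= q)%N by move: pq; rewrite /s /d; nia.
(* Base 16 because the threshold [M0] and the shrinking over [d * K] steps each cost at most
   [4 ^ K]. *)
exists (16 ^ C)%N => n nC; pose K := trunc_log 16 n.
have CK : (C <= K)%N by apply: trunc_log_max.
have n0 : (0 < n)%N by apply: leq_trans nC; rewrite expn_gt0.
have Kn : (16 ^ K <= n)%N by apply: trunc_logP.
have nL : (n <= 2 ^ (4 * K.+1))%N by rewrite expnM ltnW // trunc_log_ltn.
have K2 : (2 <= K)%N by apply: leq_trans CK; rewrite /C; lia.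
have n16 : (16 <= n)%N.
  by apply: leq_trans Kn; rewrite -[leqLHS]expn1 leq_exp2l // ltnW.
have s0 : (0 < s)%N by rewrite /s !muln_gt0 p0.
have [sigma [leg fin]] := strategy_red_sparse R p0 s0 sq n16 nL.
exists sigma; split=> // t h A B H u0; have [AB red] := fin t h A B H u0.
have cA : (clique_number A <= 3 * p * (4 * K.+1) + 2)%N.
  by apply/bigmax_leqP => X XA; apply: (red_clique_small p0 _ (red X) XA); reflexivity.
pose M0 := (2 * s * (4 * K.+1) + 2 + 2 * d.+1)%N.
have M0K : (M0 <= 4 ^ K)%N.
  (* Both [C <= K] and [K + 1] are at most [2 ^ K]. *)
  apply: (@leq_trans (C * K.+1)); first by rewrite /M0 /C; clear; nia.
  rewrite (expnMn 2 2); apply: leq_mul; last exact: ltn_expl.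
  exact: leq_trans CK (ltnW (ltn_expl _ _)).
have step (X : {set 'I_n}) : (M0 <= #|X|)%N ->
    exists2 v, v \in X & (d * #|X| <= d.+1 * #|blue_nbrs B X v|)%N.
  by apply: (blue_step AB p0 _ red); reflexivity.
have M0_gt0 : (0 < M0)%N by rewrite /M0; lia.
have [|S [_ SB St]] := blue_clique M0_gt0 step (t := (d * K)%N) (X := setT).
  rewrite cardsT card_ord !(expnM _ d K).
  have h1 : ((d.+1 ^ d) ^ K <= 4 ^ K * (d ^ d) ^ K)%N.
    rewrite -expnMn leq_exp2r; last exact: ltnW.
    by apply: succ_pow_le4; rewrite /d muln_gt0 p0.
  apply: leq_trans (leq_mul M0K h1) _.
  by rewrite mulnA -expnMn leq_mul2r Kn orbT.
apply: clique_number_gt SB _; rewrite St; apply: leq_ltn_trans cA _.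
rewrite /d; clear -p0 K2; nia.
Qed.
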